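(* Let $P_1=(x_1,\dots,x_t)$, $P_2=(x_{s+1},\dots,x_r)$, $P_3=(x_{q+1},\dots,x_n)$ be prime ideals of $S=K[x_1,\dots,x_n]$ with $s\le t$, $q\le r$, $s<r$, and $P_i\not\subset P_j$ for all $i\neq j$, and let $I=P_1\cap P_2\cap P_3$. Let $$d:=\min\left\{\frac{2n+t-r-s+2}{2},\ \frac{n+r+s-q+2}{2},\ n-\left\lfloor\frac{t}{2}\right\rfloor,\ n-\left\lfloor\frac{r-s}{2}\right\rfloor,\ n-\left\lfloor\frac{n-q}{2}\right\rfloor\right\}.$$ Then $\operatorname{sdepth}(I)\le d$ if $t\ge q$, and $$\operatorname{sdepth}(I)\le\min\left\{d,\ \frac{n+q-t+2}{2}\right\}\quad\text{if } t<q.$$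
   Context: $K$ is a field and $S=K[x_1,\dots,x_n]$ is the polynomial ring, with its standard $\mathbb{Z}^n$-grading. The indices $s,t,q,r$ are integers between $0$ and $n$. Let $M$ be a finitely generated $\mathbb{Z}^n$-graded $S$-module. For a homogeneous $u\in M$ and a subset $Z\subset\{x_1,\dots,x_n\}$, $uK[Z]$ denotes the $K$-subspace of $M$ generated by all $uv$, $v$ a monomial in $K[Z]$; if $uK[Z]$ is a free $K[Z]$-module it is called a Stanley space of dimension $|Z|$. A Stanley decomposition of $M$ is a presentation of $M$ as a finite direct sum of $\mathbb{Z}^n$-graded $K$-vector spaces $\mathcal{D}: M=\bigoplus_{i}u_iK[Z_i]$ with each $u_iK[Z_i]$ a Stanley space; $\operatorname{sdepth}\mathcal{D}=\min_i|Z_i|$, and $\operatorname{sdepth} M$ is the maximum of $\operatorname{sdepth}\mathcal{D}$ over all Stanley decompositions $\mathcal{D}$ of $M$. *)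

(* Defs.v *)
From HB Require Import structures.
From mathcomp Require Import all_boot all_order all_algebra.
From mathcomp Require Import boolp mpoly.

Set Implicit Arguments.
Unset Strict Implicit.
Unset Printing Implicit Defensive.

Import Order.TTheory GRing.Theory Num.Theory.

Local Open Scope ring_scope.

(* The variables x_1, ..., x_n are 'X_0, ..., 'X_(n-1), indexed by 'I_n. *)

Definition zdeg (n : nat) (m : 'X_{1..n}) : {ffun 'I_n -> int} :=
  [ffun i => (m i)%:Z].

Record multigrading (K : fieldType) (n : nat) (M : lmodType {mpoly K[n]}) :=
  Multigrading {
    piece :> {ffun 'I_n -> int} -> M -> Prop;
    piece0 : forall a, piece a 0;
    pieceD : forall a u v, piece a u -> piece a v -> piece a (u + v);
    pieceZ : forall a (c : K) (m : 'X_{1..n}) v,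
      piece a v -> piece (zdeg m + a) ((c *: 'X_[m]) *: v);
    piece_sum : forall v, exists (A : seq {ffun 'I_n -> int}) w,
      (forall a, piece a (w a)) /\ v = \sum_(a <- A) w a;
    piece_direct : forall (A : seq {ffun 'I_n -> int}) w,
      uniq A -> (forall a, piece a (w a)) -> \sum_(a <- A) w a = 0 ->
      forall a, a \in A -> w a = 0
  }.

Section StanleyDepth.

Variables (K : fieldType) (n : nat) (M : lmodType {mpoly K[n]}).
Variable gr : multigrading M.

Definition homogeneous (u : M) : Prop := exists a, gr a u.

Definition monomial_in (Z : {set 'I_n}) (m : 'X_{1..n}) : bool :=
  [forall i, (i \notin Z) ==> (m i == 0%N)].

(* Membership in K[Z]. *)
Definition poly_in (Z : {set 'I_n}) (p : {mpoly K[n]}) : bool :=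
  all (monomial_in Z) (msupp p).

(* Membership in uK[Z]. *)
Definition stanley_span (u : M) (Z : {set 'I_n}) (w : M) : Prop :=
  exists (s : seq 'X_{1..n}) (c : 'X_{1..n} -> K),
    all (monomial_in Z) s /\ w = \sum_(m <- s) c m *: 'X_[m] *: u.

(* uK[Z] is free over K[Z] on the generator u; in particular u is nonzero. *)
Definition stanley_space (u : M) (Z : {set 'I_n}) : Prop :=
  homogeneous u /\ forall p, poly_in Z p -> p *: u = 0 -> p = 0.

(* Graded modules are given as graded submodules N of M; taking N to be all of
   M gives the notion for M itself. *)
Definition stanley_decomposition (N : M -> Prop) (k : nat)
    (u : 'I_k -> M) (Z : 'I_k -> {set 'I_n}) : Prop :=
  [/\ forall i, stanley_space (u i) (Z i),
      forall v, N v <->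
        exists w : 'I_k -> M,
          (forall i, stanley_span (u i) (Z i) (w i)) /\ v = \sum_i w i
    & forall w : 'I_k -> M,
        (forall i, stanley_span (u i) (Z i) (w i)) -> \sum_i w i = 0 ->
        forall i, w i = 0].

(* The value n for the empty family is only reached when N is zero. *)
Definition sdepth_decomposition (k : nat) (Z : 'I_k -> {set 'I_n}) : nat :=
  \big[minn/n]_i #|Z i|.

Definition sdepth (N : M -> Prop) : nat :=
  \max_(d < n.+1 | `[< exists k (u : 'I_k -> M) (Z : 'I_k -> {set 'I_n}),
                        stanley_decomposition N u Z
                        /\ sdepth_decomposition Z = d >]) d.

(* The bound d < n.+1 in sdepth excludes no decomposition. *)
Lemma sdepth_decomposition_le (k : nat) (Z : 'I_k -> {set 'I_n}) :
  (sdepth_decomposition Z <= n)%N.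
Proof.
apply: (big_ind (fun x => x <= n)%N) => // [x y hx _|i _].
  by rewrite geq_min hx.
by rewrite -[leqRHS](card_ord n) max_card.
Qed.

Lemma sdepth_ge (N : M -> Prop) (k : nat)
    (u : 'I_k -> M) (Z : 'I_k -> {set 'I_n}) :
  stanley_decomposition N u Z -> (sdepth_decomposition Z <= sdepth N)%N.
Proof.
move=> h; have lt : (sdepth_decomposition Z < n.+1)%N.
  by rewrite ltnS sdepth_decomposition_le.
apply: (leq_bigmax_cond (Ordinal lt)).
by apply/asboolP; exists k, u, Z.
Qed.

End StanleyDepth.

Section PolynomialRing.

Variables (K : fieldType) (n : nat).

Definition std_piece (a : {ffun 'I_n -> int}) (f : {mpoly K[n]}^o) : Prop :=
  forall m, m \in msupp (f : {mpoly K[n]}) -> zdeg m = a.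

Lemma zdeg_inj : injective (@zdeg n).
Proof.
move=> m1 m2 /ffunP e; apply/mnmP => i.
by have := e i; rewrite !ffunE => -[].
Qed.

Lemma zdegD (m1 m2 : 'X_{1..n}) : zdeg (m1 + m2)%MM = zdeg m1 + zdeg m2.
Proof. by apply/ffunP => i; rewrite !ffunE mnmDE PoszD. Qed.

Fact std_piece0 a : std_piece a 0.
Proof. by move=> m; rewrite msupp0. Qed.

Fact std_pieceD a u v :
  std_piece a u -> std_piece a v -> std_piece a (u + v).
Proof.
by move=> hu hv m /msuppD_le; rewrite mem_cat => /orP[/hu|/hv].
Qed.

Fact std_pieceZ a (c : K) (m : 'X_{1..n}) v :
  std_piece a v -> std_piece (zdeg m + a) ((c *: 'X_[m]) *: v).
Proof.
move=> hv m'; rewrite [X in msupp X](_ : _ = c *: ('X_[m] * v)); last first.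
  by rewrite scalerAl.
move=> /msuppZ_le; rewrite mulrC (perm_mem (msuppMX _ _)) => /mapP[m1 /hv <- ->].
by rewrite zdegD.
Qed.

Fact std_piece_sum (v : {mpoly K[n]}^o) :
  exists (A : seq {ffun 'I_n -> int}) w,
    (forall a, std_piece a (w a)) /\ v = \sum_(a <- A) w a.
Proof.
pose w a : {mpoly K[n]}^o :=
  \sum_(m <- msupp (v : {mpoly K[n]}) | zdeg m == a) (v@_m *: 'X_[m]).
exists (map (@zdeg n) (msupp (v : {mpoly K[n]}))), w; split=> [a|].
  rewrite /w; apply: (big_ind (std_piece a)).
  - exact: std_piece0.
  - exact: std_pieceD.
  - by move=> m /eqP <- m' /msuppZ_le; rewrite msuppX inE => /eqP->.
rewrite big_map {1}[v]mpolyE; apply: eq_big_seq => m hm.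
rewrite /w big_mkcond (bigD1_seq m) ?msupp_uniq //= eqxx big1 ?addr0 //.
by move=> m' /negPf ne; rewrite (inj_eq zdeg_inj) ne.
Qed.

Fact std_piece_direct (A : seq {ffun 'I_n -> int}) w :
  uniq A -> (forall a, std_piece a (w a)) -> \sum_(a <- A) w a = 0 ->
  forall a, a \in A -> w a = 0.
Proof.
move=> uA hw h0 a aA; apply/eqP; rewrite -msupp_eq0.
case E: (msupp _) => [//|m s].
have hm : m \in msupp (w a : {mpoly K[n]}) by rewrite E mem_head.
have := congr1 (mcoeff m) h0; rewrite raddf_sum mcoeff0 (bigD1_seq a) //=.
rewrite big1 ?addr0 => [/eqP|b ba]; first by rewrite mcoeff_eq0 hm.
apply/eqP; rewrite mcoeff_eq0; apply/negP => /hw e.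
by rewrite -e (hw _ _ hm) eqxx in ba.
Qed.

Definition std_grading : multigrading {mpoly K[n]}^o :=
  Multigrading std_piece0 std_pieceD std_pieceZ std_piece_sum
    std_piece_direct.

(* The ideal generated by the variables 'X_i, i in A. *)
Definition var_ideal (A : {set 'I_n}) (f : {mpoly K[n]}) : Prop :=
  exists c : 'I_n -> {mpoly K[n]}, f = \sum_(i in A) c i * 'X_i.

End PolynomialRing.

(* Main.v *)
Require Import Defs.
From HB Require Import structures.
From mathcomp Require Import all_boot all_order all_algebra.
From mathcomp Require Import boolp mpoly.
From mathcomp Require Import zify lra.
Import Order.TTheory GRing.Theory Num.Theory.
Local Open Scope ring_scope.

Set Implicit Arguments.
Unset Strict Implicit.
Unset Printing Implicit Defensive.

(** All the bounds are instances of one bound for an intersection I of primes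
P_k generated by sets A_k of variables, k in a finite set J.  Choose a subset
C of J, and let B_k be the part of A_k that avoids the sets A_b with b in C
and b <> k.  If no B_k is empty, then

  2 sdepth I <= 2 n - sum_(a in C) |B_a| + |C|    ([sdepth_var_ideals_le]).

A Stanley decomposition of I partitions the exponents of the monomials of I
into cells b_i + N^Z_i ([stanley_decomposition_cells]).  Choose one variable
x_k in B_k for each k in J.  The product m_x of these variables lies in I, but
it leaves I when one of its factors x_a with a in C is dropped, since none of
the other factors lies in A_a.  Hence the generator of the cell that contains
m_x is divisible by each x_a with a in C.

Now let a be in C and let j be a variable of B_a other than x_a; let x' be
obtained from x by exchanging x_a for j, so that m_x j = m_x' x_a.  If j were
a free direction of the cell of m_x, and x_a a free direction of the cell of
m_x', this monomial would lie in both cells; the cells would be equal, and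
x_a would divide its generator, which divides m_x'.  That is impossible.  The
exchange (x, j) <-> (x', x_a) is an involution, so, on average over x, at most
half of the directions j of the B_a are free in the cell of m_x
([swap_half]).  Some x therefore has a cell of dimension at most
n - sum |B_a| + |C| + (sum (|B_a| - 1)) / 2, with sums over a in C.

A single prime, |C| = 1, gives the three bounds with integer parts, and a pair
of primes, |C| = 2, gives the others.  The factors x_k with k outside C do the
work of passing to a colon ideal of I in which only the primes indexed by C
survive; discarding the variables outside the B_a removes the overlap of two
primes.  The pair P_1, P_3 is available only if t < q: otherwise P_1 and P_3
together contain all the variables, and no generator of P_2 is left to
choose. *)

(** * Ideals generated by variables *)

Section VarIdeal.
Variables (K : fieldType) (n : nat).

Lemma var_ideal_monomial (A : {set 'I_n}) (m : 'X_{1..n}) :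
  var_ideal (K := K) A 'X_[m] <-> exists2 i, i \in A & (0 < m i)%N.
Proof.
split=> [[c e]|[i iA mi]].
  apply: contrapT => no.
  have := congr1 (mcoeff m) e; rewrite mcoeffX eqxx raddf_sum big1 => [|i iA].
    by move/eqP; rewrite oner_eq0.
  apply/eqP; rewrite /= mcoeff_eq0 (perm_mem (msuppMX _ _)).
  apply/mapP => -[m' _ em]; apply: no; exists i => //.
  by rewrite em mnmDE mnm1E eqxx addnC addn1.
exists (fun j => if j == i then 'X_[m - U_(i)] else 0).
rewrite (bigD1 i) //= eqxx big1 ?addr0 => [|j /andP[_ /negPf ->]].
  by rewrite -mpolyXD submK // lep1mP -lt0n.
by rewrite mul0r.
Qed.

Lemma var_ideal_sub (A B : {set 'I_n}) (f : {mpoly K[n]}) :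
  A \subset B -> var_ideal A f -> var_ideal B f.
Proof.
move=> /subsetP AB [c ->]; exists (fun i => if i \in A then c i else 0).
rewrite (bigID (mem A) (mem B)) /= [X in _ + X]big1 ?addr0; last first.
  by move=> i /andP[_ /negPf ->]; rewrite mul0r.
by apply: eq_big => [i|i ->] //; case: (boolP (i \in A)) => [/AB ->|]; rewrite ?andbF.
Qed.

Lemma var_ideal_nsub (A B : {set 'I_n}) :
  ~ (forall f : {mpoly K[n]}, var_ideal A f -> var_ideal B f) ->
  exists2 i, i \in A & i \notin B.
Proof.
by move=> h; apply/subsetPn/negP => AB; apply: h => f; apply: var_ideal_sub.
Qed.

End VarIdeal.

(** * Stanley decompositions as partitions of exponents *)

Section Cells.
Variables (K : fieldType) (n : nat).

(** The exponents of the monomials of 'X_[b]K[Z]. *)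
Definition cell (b : 'X_{1..n}) (Z : {set 'I_n}) (m : 'X_{1..n}) : bool :=
  [forall j, if j \in Z then (b j <= m j)%N else b j == m j].

Lemma cellP b Z m : reflect (exists2 z, monomial_in Z z & m = (z + b)%MM) (cell b Z m).
Proof.
apply: (iffP forallP) => [h|[z /forallP hz ->] j]; last first.
  have := hz j; rewrite mnmDE; case: (j \in Z) => /= [_|/eqP ->].
    exact: leq_addl.
  by rewrite add0n.
exists (m - b)%MM.
  apply/forallP => j; have := h j; rewrite mnmBE.
  by case: (j \in Z) => //= /eqP ->; rewrite subnn.
by rewrite submK //; apply/mnm_lepP => j; have := h j; case: ifP => // _ /eqP ->.
Qed.

(** The pieces of the grading are at most one-dimensional: [zdeg] is
injective. *)
Lemma homogeneous_monomial (u : {mpoly K[n]}^o) :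
  homogeneous (std_grading K n) u -> u != 0 ->
  exists b c, c != 0 /\ u = c *: 'X_[b] :> {mpoly K[n]}.
Proof.
move=> [a hu] u0; pose b := mlead (u : {mpoly K[n]}).
have bu : b \in msupp (u : {mpoly K[n]}) by apply: mlead_supp.
exists b, (u@_b); split; first by rewrite -mcoeff_msupp.
rewrite [LHS]mpolyE (bigD1_seq b) ?msupp_uniq //= big1_seq ?addr0 // => m /andP[mb mu].
by case/eqP: mb; apply: (@zdeg_inj n); rewrite (hu _ mu) (hu _ bu).
Qed.

(** A homogeneous generator is a multiple of one monomial 'X_[b]; hence the
monomials that occur in uK[Z] are exactly those of one cell. *)
Lemma stanley_span_cell (b : 'X_{1..n}) (c : K) (Z : {set 'I_n})
    (w : {mpoly K[n]}^o) m :
  stanley_span ((c *: 'X_[b] : {mpoly K[n]}) : {mpoly K[n]}^o) Z w ->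
  m \in msupp (w : {mpoly K[n]}) -> cell b Z m.
Proof.
move=> [s [d [/allP hs ->]]] /msupp_sum_le /flattenP[_ /mapP[z zs ->]].
rewrite mem_filter /= in zs.
have -> : (d z *: 'X_[z]) *: ((c *: 'X_[b] : {mpoly K[n]}) : {mpoly K[n]}^o)
   = (d z * c) *: 'X_[z + b] :> {mpoly K[n]}.
  rewrite [LHS](_ : _ = (d z *: 'X_[z]) * (c *: 'X_[b])) //.
  by rewrite -scalerAl -scalerAr scalerA mpolyXD.
move=> /msuppZ_le; rewrite msuppX inE => /eqP ->.
by apply/cellP; exists z => //; apply: hs.
Qed.

Lemma cell_stanley_span (b : 'X_{1..n}) (c e : K) (Z : {set 'I_n}) m :
  c != 0 -> cell b Z m ->
  stanley_span ((c *: 'X_[b] : {mpoly K[n]}) : {mpoly K[n]}^o) Z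
    (e *: 'X_[m] : {mpoly K[n]}).
Proof.
move=> c0 /cellP[z hz ->]; exists [:: z], (fun=> e / c); rewrite /= hz; split=> //.
rewrite big_seq1 [RHS](_ : _ = ((e / c) *: 'X_[z]) * (c *: 'X_[b])) //.
by rewrite -scalerAl -scalerAr scalerA mpolyXD divfK.
Qed.

(** A monomial of a sum of spans occurs in one of the summands, which gives
the covering; if it belonged to two cells, then taking it in one span and its
opposite in the other would contradict directness. *)
Lemma stanley_decomposition_cells (N : {mpoly K[n]}^o -> Prop) k u Z :
  stanley_decomposition (std_grading K n) N u Z ->
  exists b : 'I_k -> 'X_{1..n},
    (forall m, N ('X_[m] : {mpoly K[n]}) <-> exists i, cell (b i) (Z i) m) /\
    (forall m i j, cell (b i) (Z i) m -> cell (b j) (Z j) m -> i = j).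
Proof.
move=> [hu hN hdir].
have /choice[bc hbc] i : exists bc : 'X_{1..n} * K,
    bc.2 != 0 /\ u i = (bc.2 *: 'X_[bc.1] : {mpoly K[n]}).
  have [hom free] := hu i; have [|b [c h]] := homogeneous_monomial hom.
    apply/eqP => u0; have p1 : poly_in (Z i) (1 : {mpoly K[n]}).
      rewrite /poly_in msupp1 /= andbT; apply/forallP => j.
      by rewrite mnm0E eqxx implybT.
    have := free 1 p1; rewrite u0 scaler0 => /(_ erefl)/eqP.
    by rewrite oner_eq0.
  by exists (b, c).
exists (fun i => (bc i).1); split=> [m|m i j ci cj].
  split=> [/hN[w [hw e]]|[i ci]].
    have : m \in msupp (\sum_i (w i : {mpoly K[n]})).
      by rewrite -[X in msupp X]e msuppX inE.
    move=> /msupp_sum_le /flattenP[_ /mapP[i _ ->] mi]; exists i.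
    have := hw i; have [_ ->] := hbc i; move=> /stanley_span_cell; exact.
  apply/hN; exists (fun j => if j == i then 'X_[m] : {mpoly K[n]} else 0); split.
    move=> j; case: eqP => [->|_].
      have [c0 ->] := hbc i; rewrite -['X_[m]]scale1r; exact: cell_stanley_span.
    by exists [::], (fun=> 0); rewrite big_nil.
  by rewrite (bigD1 i) //= eqxx big1 ?addr0 // => j /negPf ->.
apply/eqP; apply: contraT => ij.
(* 'X_[m] in the i-th span and its opposite in the j-th one sum to 0. *)
pose w l : {mpoly K[n]} :=
  if l == i then 1 *: 'X_[m] else if l == j then (-1) *: 'X_[m] else 0.
have wP l : stanley_span (u l) (Z l) (w l : {mpoly K[n]}^o).
  rewrite /w; case: eqP => [->|_].
    by have [c0 ->] := hbc i; apply: cell_stanley_span.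
  case: eqP => [->|_]; first by have [c0 ->] := hbc j; apply: cell_stanley_span.
  by exists [::], (fun=> 0); rewrite big_nil.
have w0 : \sum_l (w l : {mpoly K[n]}^o) = 0.
  rewrite (bigD1 i) //= (bigD1 j) 1?eq_sym //= big1 => [|l /andP[li lj]].
    by rewrite /w eqxx [j == i]eq_sym (negPf ij) eqxx scaleN1r scale1r addr0 subrr.
  by rewrite /w (negPf li) (negPf lj).
have := hdir _ wP w0 i; rewrite /w eqxx scale1r => X0.
have : m \in msupp ('X_[m] : {mpoly K[n]}) by rewrite msuppX mem_head.
by rewrite [X in msupp X]X0 msupp0.
Qed.

Lemma cell_step b (Z : {set 'I_n}) m j :
  cell b Z m -> j \in Z -> cell b Z (m + U_(j))%MM.
Proof.
move=> /forallP h jZ; apply/forallP => i; have := h i; rewrite mnmDE mnm1E.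
case: ifP => [_|iZ /eqP ->]; first by move=> le; apply: leq_trans le (leq_addr _ _).
by case: (j =P i) => [ij|_]; [rewrite -ij jZ in iZ | rewrite addn0].
Qed.

Lemma cell_le b (Z : {set 'I_n}) m i : cell b Z m -> (b i <= m i)%N.
Proof. by move=> /forallP/(_ i); case: ifP => // _ /eqP ->. Qed.

End Cells.

Lemma sdepth_decomposition_le_card (n k : nat) (Z : 'I_k -> {set 'I_n}) i :
  (sdepth_decomposition Z <= #|Z i|)%N.
Proof.
rewrite /sdepth_decomposition -minEnat -leEnat.
exact: bigmin_le.
Qed.

(** * Exchanging one element of a transversal *)

Section Transversals.
Variables (T J : finType) (B : J -> {set T}).

Lemma cardsI_sum (S U : {set T}) : #|S :&: U| = (\sum_(j in U) (j \in S))%N.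
Proof.
rewrite -sum1_card (eq_bigl (fun j => (j \in U) && (j \in S))); last first.
  by move=> j; rewrite inE andbC.
by rewrite big_mkcondr; apply: eq_bigr => j _; case: (j \in S).
Qed.

Definition swap (x : {ffun J -> T}) (a : J) (j : T) : {ffun J -> T} :=
  [ffun k => if k == a then j else x k].

Lemma swap_family x a j : x \in family B -> j \in B a -> swap x a j \in family B.
Proof.
move=> /familyP xB jB; apply/familyP => k; rewrite ffunE.
by case: eqP => [->|_] //; apply: xB.
Qed.

Lemma swapK x a j : swap (swap x a j) a (x a) = x.
Proof. by apply/ffunP => k; rewrite !ffunE; case: eqP => [->|]. Qed.

(** The involution (x, j) |-> (swap x a j, x a) maps the pairs with j in Z x
into the pairs with j outside Z x, so the former are at most half of all
the pairs. *)
Lemma swap_half (Z : {ffun J -> T} -> {set T}) (a : J) :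
    (forall x j, x \in family B -> j \in B a :\ x a -> j \in Z x ->
       x a \notin Z (swap x a j)) ->
  (2 * (\sum_(x in family B) #|Z x :&: (B a :\ x a)|) <=
   \sum_(x in family B) #|B a :\ x a|)%N.
Proof.
move=> excl.
pose D (p : {ffun J -> T} * T) := (p.1 \in family B) && (p.2 \in B a :\ p.1 a).
pose f (p : {ffun J -> T} * T) := (swap p.1 a p.2, p.1 a).
have fK : involutive f by case=> x j; rewrite /f /= swapK ffunE eqxx.
have Df p : D p -> D (f p).
  case: p => x j /andP[/= xB]; rewrite !inE => /andP[jx jB].
  rewrite /D /= swap_family //= !inE ffunE eqxx eq_sym jx.
  by move/familyP: xB; apply.
have DfE p : D (f p) = D p.
  by apply/idP/idP => [/Df|/Df //]; rewrite fK.
have -> : (\sum_(x in family B) #|Z x :&: (B a :\ x a)| =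
           \sum_(p | D p) (p.2 \in Z p.1))%N.
  under eq_bigr => x _ do rewrite cardsI_sum.
  by rewrite pair_big_dep.
have -> : (\sum_(x in family B) #|B a :\ x a| = \sum_(p | D p) 1)%N.
  under eq_bigr => x _ do rewrite -sum1_card.
  by rewrite pair_big_dep.
rewrite mul2n -addnn {2}(reindex_inj (inv_inj fK)) /=.
under [X in (_ + X)%N]eq_bigl => p do rewrite DfE.
rewrite -big_split; apply: leq_sum => -[x j] /andP[/= xB jB].
by case: (boolP (j \in Z x)) => jZ; rewrite ?(negPf (excl _ _ xB jB jZ)) ?leq_b1.
Qed.

(** The directions of Z that the sums over C do not see number at most |C|,
namely the chosen elements x a, plus those outside the disjoint B a. *)
Lemma card_disjoint_le (C : {set J}) (Z : {set T}) (x : J -> T) :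
    (forall a b j, a \in C -> b \in C -> j \in B a -> j \in B b -> a = b) ->
  (#|Z| + \sum_(a in C) #|B a| <=
   #|T| + #|C| + \sum_(a in C) #|Z :&: (B a :\ x a)|)%N.
Proof.
move=> disj.
have h : (\sum_(a in C) #|B a :\: Z| <= #|~: Z|)%N.
  have E (S : {set T}) : #|S| = (\sum_j (j \in S))%N.
    by rewrite -sum1_card big_mkcond; apply: eq_bigr => j _; case: (j \in S).
  under eq_bigr => a _ do rewrite E.
  rewrite E exchange_big; apply: leq_sum => j _.
  under eq_bigr => a _ do rewrite inE.
  rewrite inE; case: (j \in Z) => /=; first by rewrite big1.
  have [a /andP[aC ja]|no] := pickP (fun a => (a \in C) && (j \in B a)).
    rewrite (bigD1 a) //= ja big1 // => b /andP[bC].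
    by apply: contraNeq; rewrite eqb0 negbK => jb; rewrite (disj b a j).
  by rewrite big1 // => a aC; have := no a; rewrite aC /= => ->.
have h' : (\sum_(a in C) #|B a| <=
    \sum_(a in C) #|B a :\: Z| + (#|C| + \sum_(a in C) #|Z :&: (B a :\ x a)|))%N.
  rewrite -sum1_card -!big_split /=; apply: leq_sum => a _.
  rewrite -(cardsID Z (B a)) addnC leq_add2l setIC.
  by rewrite (cardsD1 (x a) (Z :&: B a)) leq_add ?leq_b1 // setIDA.
have := cardsC Z; lia.
Qed.

(** The bounds of [swap_half] add up over C, so an average transversal
satisfies the sum of them. *)
Lemma exists_balanced_transversal (C : {set J})
    (Z : {ffun J -> T} -> {set T}) (x0 : {ffun J -> T}) :
    x0 \in family B ->
    (forall a x j, a \in C -> x \in family B -> j \in B a :\ x a -> j \in Z x ->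
       x a \notin Z (swap x a j)) ->
  exists2 x, x \in family B &
    (2 * (\sum_(a in C) #|Z x :&: (B a :\ x a)|) <=
     \sum_(a in C) #|B a :\ x a|)%N.
Proof.
move=> x0B excl; apply: contrapT => no.
have h : (\sum_(x in family B) (\sum_(a in C) #|B a :\ x a| + 1) <=
    \sum_(x in family B) 2 * (\sum_(a in C) #|Z x :&: (B a :\ x a)|))%N.
  apply: leq_sum => x xB; rewrite addn1 ltnNge; apply/negP => le.
  by apply: no; exists x.
have : (\sum_(x in family B) 2 * (\sum_(a in C) #|Z x :&: (B a :\ x a)|) <=
        \sum_(x in family B) (\sum_(a in C) #|B a :\ x a|))%N.
  rewrite -big_distrr /= [X in (2 * X)%N]exchange_big big_distrr /=.
  rewrite [X in (_ <= X)%N]exchange_big /=.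
  by apply: leq_sum => a aC; apply: swap_half => x j; apply: excl.
move/(leq_trans h); rewrite big_split /= -[leqRHS]addn0 leq_add2l leqn0 sum1_card.
by rewrite (cardD1 x0) x0B.
Qed.

End Transversals.

(** * Intersections of primes *)

Section PrimeIntersection.
Variables (K : fieldType) (n : nat) (J : finType).
Variables (A : J -> {set 'I_n}) (C : {set J}).

(** For k outside C, no condition b <> k is active, and [private k] avoids
all the sets indexed by C. *)
Definition private (k : J) : {set 'I_n} := A k :\: \bigcup_(b in C :\ k) A b.

(** This makes exchanges detectable: among the factors of a transversal monomial,
a variable of A a with a in C can only be the one chosen for a. *)
Lemma private_eq a k j : a \in C -> j \in A a -> j \in private k -> k = a.
Proof.
move=> aC ja; rewrite inE => /andP[jn _]; apply/eqP; apply: contraNT jn => ka.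
by apply/bigcupP; exists a => //; rewrite !inE eq_sym ka.
Qed.

Lemma private_sub k : private k \subset A k. Proof. exact: subsetDl. Qed.

Definition transversal_mnm (x : {ffun J -> 'I_n}) : 'X_{1..n} :=
  (\sum_k U_(x k))%MM.

Lemma transversal_mnm_gt0 x i :
  (0 < transversal_mnm x i)%N -> exists k, i = x k.
Proof.
rewrite /transversal_mnm mnm_sumE => h; apply: contrapT => no.
move: h; rewrite big1 // => k _; rewrite mnm1E; case: eqP => // e.
by case: no; exists k.
Qed.

Lemma transversal_mnmE x k : (0 < transversal_mnm x (x k))%N.
Proof. by rewrite /transversal_mnm mnm_sumE (bigD1 k) //= mnm1E eqxx. Qed.

(** The monomial at which the cells of a transversal and of its exchange
would meet. *)
Lemma transversal_mnm_swap x a j :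
  (transversal_mnm (swap x a j) + U_(x a) = transversal_mnm x + U_(j))%MM.
Proof.
rewrite /transversal_mnm (bigD1 a) // [in RHS](bigD1 a) //= ffunE eqxx.
rewrite (eq_bigr (fun k => U_(x k)%MM)) => [|k /negPf ka]; last by rewrite ffunE ka.
by apply/mnmP => i; rewrite !mnmDE addnC addnA addnAC.
Qed.

(** A balanced transversal has a cell with few free directions in the
private parts; [card_disjoint_le] then bounds its dimension, and so the Stanley
depth of the decomposition.  Balancing applies because free exchanges in both
directions would put x and its exchange in the same cell, whose generator
would have to contain the exchanged variable x a. *)
Lemma sdepth_var_ideals_le (N : {mpoly K[n]}^o -> Prop) :
    (forall f, N f <-> forall k, var_ideal (A k) f) ->
    (forall k, private k != set0) ->
  (2 * sdepth (std_grading K n) N + \sum_(a in C) #|private a| <= 2 * n + #|C|)%N.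
Proof.
move=> hN hpriv.
have /fin_all_exists[x0 hx0] k : exists i, i \in private k by apply/set0Pn.
have x0B : [ffun k => x0 k] \in family private.
  by apply/familyP => k; rewrite ffunE.
have N_mon m : N ('X_[m] : {mpoly K[n]}) <->
    forall k, exists2 i, i \in A k & (0 < m i)%N.
  by rewrite hN; split=> h k; apply/(var_ideal_monomial K); apply: h.
have disj a a' j : a \in C -> a' \in C -> j \in private a -> j \in private a' -> a = a'.
  move=> aC a'C ja ja'; apply: (private_eq a'C _ ja).
  exact: (subsetP (private_sub a')).
have bound d : (exists p (u : 'I_p -> {mpoly K[n]}^o) Z,
      stanley_decomposition (std_grading K n) N u Z /\ sdepth_decomposition Z = d) ->
    (2 * d + \sum_(a in C) #|private a| <= 2 * n + #|C|)%N.
  move=> [p [u [Z [dec <-]]]].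
  have [b [hcover huniq]] := stanley_decomposition_cells dec.
  have cover x : x \in family private ->
      exists i, cell (b i) (Z i) (transversal_mnm x).
    move=> /familyP xB; apply/hcover/N_mon => k; exists (x k).
      by apply: (subsetP (private_sub k)); apply: xB.
    exact: transversal_mnmE.
  (* The default index of a cell outside the family of transversals. *)
  have [i0 _] := cover _ x0B.
  have /choice[q hq] x : exists i, x \in family private ->
      cell (b i) (Z i) (transversal_mnm x).
    case: (boolP (x \in family private)) => [/cover[i hi]|_]; first by exists i.
    by exists i0.
  have [x xB half] : exists2 x, x \in family private &
      (2 * (\sum_(a in C) #|Z (q x) :&: (private a :\ x a)|) <=
       \sum_(a in C) #|private a :\ x a|)%N.
    apply: (exists_balanced_transversal (Z := Z \o q) x0B) => a x j aC xB jB jZ /=.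
    have {jB} [jx jB] : j != x a /\ j \in private a.
      by move: jB; rewrite in_setD1 => /andP[].
    apply/negP => xZ; have x'B := swap_family xB jB.
    have e : q x = q (swap x a j).
      apply: (huniq (transversal_mnm x + U_(j))%MM).
        exact: cell_step (hq _ xB) jZ.
      by rewrite -(transversal_mnm_swap _ a); apply: cell_step (hq _ x'B) xZ.
    (* The generator of the cell is itself in the ideal: it has a variable of
       A a, and only x a is available among the factors of x. *)
    have [i iA bi] : exists2 i, i \in A a & (0 < b (q x) i)%N.
      apply: (N_mon _).1; apply/hcover; exists (q x); apply/forallP => l.
      by rewrite leqnn eqxx if_same.
    have [k ik] := transversal_mnm_gt0 (leq_trans bi (cell_le i (hq _ xB))).
    have xk l : x l \in private l by move/familyP: xB; apply.
    have ka : k = a by apply: (private_eq aC iA); rewrite ik.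
    rewrite ik ka e in bi iA.
    have [l] := transversal_mnm_gt0 (leq_trans bi (cell_le _ (hq _ x'B))).
    rewrite ffunE; case: eqP => [_ exj|la exl]; first by rewrite exj eqxx in jx.
    by apply: la; apply: (private_eq aC iA); rewrite exl.
  have := card_disjoint_le (B := private) (C := C) (Z (q x)) x.
  rewrite card_ord; move=> /(_ disj).
  have : (\sum_(a in C) #|private a :\ x a| + #|C| = \sum_(a in C) #|private a|)%N.
    rewrite -sum1_card -big_split; apply: eq_bigr => a _ /=.
    by rewrite (cardsD1 (x a) (private a)) (familyP xB) addnC.
  have : (sdepth_decomposition Z <= #|Z (q x)|)%N.
    exact: sdepth_decomposition_le_card.
  move: half; lia.
(* This subtraction does not truncate: the disjoint private parts satisfy
   sum |private a| <= n + |C|, by [card_disjoint_le] with an empty Z. *)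
suff : (sdepth (std_grading K n) N <=
        (2 * n + #|C| - \sum_(a in C) #|private a|) %/ 2)%N.
  have := card_disjoint_le set0 x0 disj; rewrite cards0 card_ord.
  rewrite [X in (_ <= _ + X)%N]big1; first lia.
  by move=> a _; rewrite set0I cards0.
apply/bigmax_leqP => d /asboolP /bound; lia.
Qed.

End PrimeIntersection.

Section FewPrimes.
Variables (K : fieldType) (n : nat) (J : finType) (A : J -> {set 'I_n}).
Variable N : {mpoly K[n]}^o -> Prop.
Hypothesis hN : forall f, N f <-> forall k, var_ideal (A k) f.

(** C = {a}: the private part of a is all of A a. *)
Corollary sdepth_le_one (a : J) :
    A a != set0 -> (forall k, k != a -> A k :\: A a != set0) ->
  (2 * sdepth (std_grading K n) N + #|A a| <= 2 * n + 1)%N.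
Proof.
move=> a0 ha.
have pa : private A [set a] a = A a.
  by rewrite /private setDv big_set0 setD0.
have := sdepth_var_ideals_le (C := [set a]) hN; rewrite big_set1 pa cards1; apply=> k.
have [->|ka] := eqVneq k a; first by rewrite pa.
suff -> : private A [set a] k = A k :\: A a by apply: ha.
rewrite /private (_ : _ :\ k = [set a]) ?big_set1 //.
by apply/setP => i; rewrite !inE; case: eqVneq => // ->; rewrite (negPf ka).
Qed.

(** C = {a, b}: the common variables of A a and A b are in no private
part. *)
Corollary sdepth_le_two (a b : J) :
    a != b -> A a :\: A b != set0 -> A b :\: A a != set0 ->
    (forall k, k != a -> k != b -> A k :\: (A a :|: A b) != set0) ->
  (2 * sdepth (std_grading K n) N + #|A a :\: A b| + #|A b :\: A a| <= 2 * n + 2)%N.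
Proof.
move=> ab hab hba hk.
have pa : private A [set a; b] a = A a :\: A b.
  by rewrite /private setU1K ?inE // big_set1.
have pb : private A [set a; b] b = A b :\: A a.
  by rewrite /private setUC setU1K ?inE 1?eq_sym // big_set1.
have := sdepth_var_ideals_le (C := [set a; b]) hN.
rewrite big_setU1 ?inE //= big_set1 pa pb cards2 ab addnA; apply=> k.
have [->|ka] := eqVneq k a; first by rewrite pa.
have [->|kb] := eqVneq k b; first by rewrite pb.
suff -> : private A [set a; b] k = A k :\: (A a :|: A b) by apply: hk.
rewrite /private (_ : _ :\ k = [set a; b]).
  by rewrite big_setU1 ?inE //= big_set1.
apply/setP => i; rewrite !inE; case: eqVneq => // ->.
by rewrite (negPf ka) (negPf kb).
Qed.

End FewPrimes.

(** * Three primes generated by intervals of variables *)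

Lemma card_ord_range (n lo hi : nat) : (hi <= n)%N ->
  #|[set i : 'I_n | (lo <= i < hi)%N]| = (hi - lo)%N.
Proof.
move=> le; rewrite -sum1dep_card.
rewrite -(big_mkord (fun i => (lo <= i < hi)%N) (fun=> 1%N)).
rewrite -[RHS]muln1 -sum_nat_const_nat [RHS](big_nat_widen _ _ n) //.
by rewrite [RHS](big_nat_widenl _ 0) //; apply: eq_bigl => i; rewrite andbC.
Qed.

Theorem proposition3p9 (K : fieldType) (n s t q r : nat)
    (hs : (s <= n)%N) (ht : (t <= n)%N) (hq : (q <= n)%N) (hr : (r <= n)%N)
    (hst : (s <= t)%N) (hqr : (q <= r)%N) (hsr : (s < r)%N) :
  let P1 := var_ideal (K := K) [set i : 'I_n | (i < t)%N] in
  let P2 := var_ideal (K := K) [set i : 'I_n | (s <= i < r)%N] in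
  let P3 := var_ideal (K := K) [set i : 'I_n | (q <= i)%N] in
  ~ (forall f, P1 f -> P2 f) -> ~ (forall f, P1 f -> P3 f) ->
  ~ (forall f, P2 f -> P1 f) -> ~ (forall f, P2 f -> P3 f) ->
  ~ (forall f, P3 f -> P1 f) -> ~ (forall f, P3 f -> P2 f) ->
  let I := fun f => [/\ P1 f, P2 f & P3 f] in
  let d : rat :=
    Num.min ((2 * n%:R + t%:R - r%:R - s%:R + 2) / 2)
   (Num.min ((n%:R + r%:R + s%:R - q%:R + 2) / 2)
   (Num.min (n%:R - (t %/ 2)%:R)
   (Num.min (n%:R - ((r - s) %/ 2)%:R)
            (n%:R - ((n - q) %/ 2)%:R)))) in
  ((q <= t)%N -> (sdepth (std_grading K n) I)%:R <= d) /\
  ((t < q)%N ->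
    (sdepth (std_grading K n) I)%:R
      <= Num.min d ((n%:R + q%:R - t%:R + 2) / 2)).
Proof.
move=> P1 P2 P3 n12 _ n21 n23 _ n32 I d.
have [i12 i21] := conj (var_ideal_nsub n12) (var_ideal_nsub n21).
have [i23 i32] := conj (var_ideal_nsub n23) (var_ideal_nsub n32).
have [t_lt_r s_lt_q] : (t < r)%N /\ (s < q)%N.
  by case: i21 i23 => [i + +] [j]; rewrite !inE; lia.
have [s_gt0 r_lt_n] : (0 < s)%N /\ (r < n)%N.
  by case: i12 i32 => [i + +] [j]; rewrite !inE; have := ltn_ord j; lia.
(* Non-containment puts x_1 in P_1 only, x_(s+1) outside P_3, x_(t+1) outside
   P_1 and x_n in P_3 only; these are the variables used as witnesses below. *)
pose A (k : 'I_3) : {set 'I_n} := nth set0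
  [:: [set i : 'I_n | (i < t)%N]; [set i : 'I_n | (s <= i < r)%N];
      [set i : 'I_n | (q <= i)%N]] k.
pose j1 : 'I_3 := @Ordinal 3 0 isT.
pose j2 : 'I_3 := @Ordinal 3 1 isT.
pose j3 : 'I_3 := @Ordinal 3 2 isT.
have hI f : I f <-> forall k, var_ideal (A k) f.
  split=> [[f1 f2 f3] [[|[|[|//]]] lt] // | h].
  by split; [apply: (h j1) | apply: (h j2) | apply: (h j3)].
have witness (S : {set 'I_n}) (i : nat) (lt : (i < n)%N) : Ordinal lt \in S -> S != set0.
  by move=> iS; apply/set0Pn; exists (Ordinal lt).
have range (S : {set 'I_n}) lo hi : (hi <= n)%N ->
    (forall i : 'I_n, (i \in S) = (lo <= i < hi)%N) -> #|S| = (hi - lo)%N.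
  move=> le h; rewrite -(card_ord_range lo le).
  by apply: eq_card => i; rewrite h inE.
set sd := sdepth _ _.
have x0 : (0 < n)%N by lia.
have xs : (s < n)%N by lia.
have xt : (t < n)%N by lia.
have xn : (n.-1 < n)%N by lia.
have b1 : (2 * sd + t <= 2 * n + 1)%N.
  have c : #|A j1| = (t - 0)%N by apply: range => // i; rewrite inE.
  rewrite -[X in (_ + X <= _)%N]subn0 -c; apply: (sdepth_le_one hI).
    by apply: (witness _ _ x0); rewrite !inE /=; lia.
  case=> -[|[|[|//]]] lt // _.
    by apply: (witness _ _ xt); rewrite !inE /=; lia.
  by apply: (witness _ _ xn); rewrite !inE /=; lia.
have b2 : (2 * sd + (r - s) <= 2 * n + 1)%N.
  have <- : #|A j2| = (r - s)%N by apply: range => // i; rewrite inE.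
  apply: (sdepth_le_one hI).
    by apply: (witness _ _ xs); rewrite !inE /=; lia.
  case=> -[|[|[|//]]] lt // _.
    by apply: (witness _ _ x0); rewrite !inE /=; lia.
  by apply: (witness _ _ xn); rewrite !inE /=; lia.
have b3 : (2 * sd + (n - q) <= 2 * n + 1)%N.
  have <- : #|A j3| = (n - q)%N.
    by apply: range => // i; rewrite inE ltn_ord andbT.
  apply: (sdepth_le_one hI).
    by apply: (witness _ _ xn); rewrite !inE /=; lia.
  case=> -[|[|[|//]]] lt // _.
    by apply: (witness _ _ x0); rewrite !inE /=; lia.
  by apply: (witness _ _ xs); rewrite !inE /=; lia.
have b12 : (2 * sd + s + (r - t) <= 2 * n + 2)%N.
  have c1 : #|A j1 :\: A j2| = (s - 0)%N.
    by apply: range => // i; rewrite !inE; lia.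
  have c2 : #|A j2 :\: A j1| = (r - t)%N.
    by apply: range => // i; rewrite !inE; lia.
  rewrite -[X in (_ + X + _)%N]subn0 -c1 -c2; apply: (sdepth_le_two hI) => //.
  - by apply: (witness _ _ x0); rewrite !inE /=; lia.
  - by apply: (witness _ _ xt); rewrite !inE /=; lia.
  case=> -[|[|[|//]]] lt // _ _.
  by apply: (witness _ _ xn); rewrite !inE /=; lia.
have b23 : (2 * sd + (q - s) + (n - r) <= 2 * n + 2)%N.
  have <- : #|A j2 :\: A j3| = (q - s)%N.
    by apply: range => // i; rewrite !inE; lia.
  have <- : #|A j3 :\: A j2| = (n - r)%N.
    by apply: range => // i; rewrite !inE; have := ltn_ord i; lia.
  apply: (sdepth_le_two hI) => //.
  - by apply: (witness _ _ xs); rewrite !inE /=; lia.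
  - by apply: (witness _ _ xn); rewrite !inE /=; lia.
  case=> -[|[|[|//]]] lt // _ _.
  by apply: (witness _ _ x0); rewrite !inE /=; lia.
have b13 : (t < q)%N -> (2 * sd + t + (n - q) <= 2 * n + 2)%N.
  move=> tq; have c1 : #|A j1 :\: A j3| = (t - 0)%N.
    by apply: range => // i; rewrite !inE; lia.
  have c3 : #|A j3 :\: A j1| = (n - q)%N.
    by apply: range => // i; rewrite !inE; have := ltn_ord i; lia.
  rewrite -[X in (_ + X + _)%N]subn0 -c1 -c3; apply: (sdepth_le_two hI) => //.
  - by apply: (witness _ _ x0); rewrite !inE /=; lia.
  - by apply: (witness _ _ xn); rewrite !inE /=; lia.
  case=> -[|[|[|//]]] lt // _ _.
  by apply: (witness _ _ xt); rewrite !inE /=; lia.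
have sd_le_d : sd%:R <= d.
  have d1 : (sd + t %/ 2 <= n)%N by lia.
  have d2 : (sd + (r - s) %/ 2 <= n)%N by lia.
  have d3 : (sd + (n - q) %/ 2 <= n)%N by lia.
  have e12 : (2 * sd + s + r <= 2 * n + t + 2)%N by lia.
  have e23 : (2 * sd + q <= n + r + s + 2)%N by lia.
  move: d1 d2 d3 e12 e23; rewrite -!(ler_nat rat) !(natrM, natrD) => d1 d2 d3 e12 e23.
  by rewrite /d !le_min; do 4?[apply/andP; split]; lra.
split=> [//|tq]; rewrite le_min sd_le_d /=.
have : (2 * sd + t <= n + q + 2)%N by have := b13 tq; lia.
by rewrite -(ler_nat rat) !(natrM, natrD); lra.
Qed.
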